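(* Let $\mathcal{D}$ be an $[n,k,d]_q$ linear code and let $M(\mathcal{D})$ be the binary matrix obtained from $\mathcal{D}$ by the Kautz-Singleton construction. Then the rate $R$ of the binary code $\mathcal{C}$ with parity-check matrix $M(\mathcal{D})$ satisfies $$R\ge 1-\frac{n}{q^{k-1}}.$$
   Context: An $[n,k,d]_q$ code is a $k$-dimensional linear subspace of $\mathbb{F}_q^n$ with minimum distance $d$ ($k\ge 1$). Kautz-Singleton construction: order the elements of $\mathbb{F}_q$ as $\alpha_1,\dots,\alpha_q$ and let $\mathbf{e}_i$ be the $i$th standard basis column vector of length $q$. The binary matrix $M(\mathcal{D})$ is formed by listing all codewords of $\mathcal{D}$ as the columns of a matrix and then replacing each symbol $\alpha_i$ with the column vector $\mathbf{e}_i$; thus $M(\mathcal{D})$ is $nq\times q^k$. The binary code with parity-check matrix $H$ (with $N$ columns) is $\{\mathbf{x}\in\mathbb{F}_2^N : H\mathbf{x}^T=\mathbf{0}\}$; if it has dimension $K$, its rate is $K/N$. *)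

(* Defs.v *)
From HB Require Import structures.
From mathcomp Require Import all_boot all_order all_algebra all_field.

Set Implicit Arguments.
Unset Strict Implicit.
Unset Printing Implicit Defensive.

Import Order.TTheory GRing.Theory Num.Theory.
Local Open Scope ring_scope.

Definition hamming_distance (F : eqType) (n : nat) (x y : 'rV[F]_n) : nat :=
  #|[set i | x 0 i != y 0 i]|.

Definition is_minimum_distance (F : finFieldType) (n : nat)
    (D : {vspace 'rV[F]_n}) (d : nat) : Prop :=
  (exists x y, [/\ x \in D, y \in D, x != y & hamming_distance x y = d]) /\
  (forall x y, x \in D -> y \in D -> x != y -> (d <= hamming_distance x y)%N).

Definition is_linear_code (F : finFieldType) (n k d q : nat)
    (D : {vspace 'rV[F]_n}) : Prop :=
  [/\ #|F| = q, (1 <= k)%N, \dim D = k & is_minimum_distance D d].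

(* If alpha has no repetition, the symbol alpha_i is sent to the standard basis
   column e_i. *)
Definition symbol_column (F : finFieldType) (q : nat) (alpha : q.-tuple F)
    (a : F) : 'cV['F_2]_q :=
  \col_i (tnth alpha i == a)%:R.

(* mxvec is row-major, so the column of w consists of n consecutive blocks of
   length q, the j-th block being the column of the j-th symbol of w. *)
Definition codeword_column (F : finFieldType) (n q : nat) (alpha : q.-tuple F)
    (w : 'rV[F]_n) : 'cV['F_2]_(n * q) :=
  (mxvec (\matrix_(j < n) (symbol_column alpha (w 0 j))^T))^T.

(* Meant for alpha enumerating F, and words enumerating a code, without
   repetition. *)
Definition kautz_singleton (F : finFieldType) (n q N : nat)
    (alpha : q.-tuple F) (words : N.-tuple 'rV[F]_n) : 'M['F_2]_(n * q, N) :=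
  \matrix_(r, c) codeword_column alpha (tnth words c) r 0.

Definition parity_check_code (m N : nat) (H : 'M['F_2]_(m, N)) :
    {vspace 'rV['F_2]_N} :=
  lker (linfun (mulmx H \o trmx)).

Lemma mem_parity_check_code (m N : nat) (H : 'M['F_2]_(m, N))
    (x : 'rV['F_2]_N) :
  (x \in parity_check_code H) = (H *m x^T == 0).
Proof. by rewrite memv_ker lfunE. Qed.

Definition code_rate (N : nat) (C : {vspace 'rV['F_2]_N}) : rat :=
  (\dim C)%:R / N%:R.

(* Main.v *)
Require Import Defs.
From HB Require Import structures.
From mathcomp Require Import all_boot all_order all_algebra all_field.

Set Implicit Arguments.
Unset Strict Implicit.
Unset Printing Implicit Defensive.

Import Order.TTheory GRing.Theory Num.Theory.
Local Open Scope ring_scope.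

(** Only the shape of the parity-check matrix matters: it has [n * q] rows and [q ^ k] columns. By
    rank-nullity ([dim_lker_ge]) its kernel has dimension at least [q ^ k - n * q], since the rank
    is at most the number of rows. Dividing by the length [q ^ k] gives the bound. *)

Lemma dim_lker_ge (K : fieldType) (m N : nat)
    (f : 'Hom('rV[K]_N, 'cV[K]_m)) : (N <= \dim (lker f) + m)%N.
Proof.
have := limg_ker_dim f fullv; rewrite capfv dimvf /dim /= mul1n => {1}<-.
by rewrite leq_add2l (leq_trans (dimvS (subvf _))) // dimvf /dim /= muln1.
Qed.

Theorem proposition3p23 (F : finFieldType) (n k d q : nat)
    (D : {vspace 'rV[F]_n}) (hD : is_linear_code k d q D)
    (alpha : q.-tuple F) (halpha : uniq alpha)
    (words : (q ^ k).-tuple 'rV[F]_n)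
    (hwords_uniq : uniq words) (hwords : words =i D) :
  1 - n%:R / q%:R ^+ k.-1
    <= code_rate (parity_check_code (kautz_singleton alpha words)).
Proof.
case: hD => cardF k_gt0 _ _.
have q_gt0 : (0 < q)%N by rewrite -cardF; apply/card_gt0P; exists 0.
have q_neq0 : q%:R != 0 :> rat by rewrite pnatr_eq0 -lt0n.
(* Use the code length as common denominator; [k_gt0] makes [k.-1] a true predecessor, so one factor
   [q] cancels. *)
have -> : 1 - n%:R / q%:R ^+ k.-1 = ((q ^ k)%:R - (n * q)%:R) / (q ^ k)%:R :> rat.
  rewrite -(prednK k_gt0) /= natrM natrX exprS mulrBl divff ?mulf_neq0 ?expf_neq0 //.
  by rewrite invfM mulrA mulfK.
(* Dropping the denominator and moving [n * q] across avoids truncated subtraction in [nat]. *)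
rewrite ler_wpM2r ?invr_ge0 ?ler0n // lerBlDr -natrD ler_nat.
exact: dim_lker_ge.
Qed.
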